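(* Let $M=([n],\mathcal{F})$ be a $\Delta$-matroid and let $r_M:2^{[n]}\to\mathbb{Z}_{\ge0}$ be its rank function. Then the function $\{0,1\}^n\to\mathbb{R}$, $e_S\mapsto -r_M(S)$, is a valuated $\Delta$-matroid.
   Context: A $\Delta$-matroid on $[n]$ is a family $\mathcal{F}$ of subsets of $[n]$ (bases) such that whenever $A,B\in\mathcal{F}$ and $a\in A\Delta B$, there exists $b\in A\Delta B$ with $A\Delta\{a,b\}\in\mathcal{F}$. Its rank function is $r_M(S)=\max_{B\in\mathcal{F}}(|B\cap S|+|B^C\cap S^C|)$, where $T^C=[n]\setminus T$. $e_S=\sum_{i\in S}e_i$. For $p:\{0,1\}^n\to\mathbb{R}\cup\{\infty\}$ let $\operatorname{dom}p=\{y:p(y)\neq\infty\}$, $P_p=\operatorname{conv}\{(y,p(y)):y\in\operatorname{dom}p\}$, and let the induced subdivision $\mathcal{S}_p$ be the set of projections (deleting last coordinate) of lower faces of $P_p$ (faces supported by hyperplanes with inner normal having positive last coordinate). Length of a segment between $0/1$-points is the Hamming distance of its endpoints. $p$ is a valuated $\Delta$-matroid if every edge of $\mathcal{S}_p$ has length at most $2$. *)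

(* Defs.v *)
From mathcomp Require Import all_boot all_order all_algebra.
From mathcomp Require Import boolp classical_sets reals.

Set Implicit Arguments.
Unset Strict Implicit.
Unset Printing Implicit Defensive.

Import Order.TTheory GRing.Theory Num.Theory.

Local Open Scope ring_scope.
Local Open Scope classical_set_scope.

(* The ground set [n] is 'I_n. *)

Definition symdiff (T : finType) (A B : {set T}) : {set T} :=
  ((A :\: B) :|: (B :\: A))%SET.

(* b = a is allowed, in which case A Delta {a, b} = A Delta {a}.
   As in the source, F is not required to be nonempty. *)
Definition delta_matroid (n : nat) (F : {set {set 'I_n}}) : Prop :=
  forall A B : {set 'I_n}, A \in F -> B \in F ->
  forall a : 'I_n, a \in symdiff A B ->
  exists2 b : 'I_n, b \in symdiff A B & symdiff A [set a; b]%SET \in F.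

Definition rank (n : nat) (F : {set {set 'I_n}}) (S : {set 'I_n}) : nat :=
  (\max_(B in F) (#|B :&: S| + #|~: B :&: ~: S|))%N%SET.

Section ConvexGeometry.
Variables (R : realType) (m : nat).
Implicit Types (X P : set 'rV[R]_m) (u v : 'rV[R]_m).

Definition conv_hull X : set 'rV[R]_m :=
  [set z | exists k (x : 'I_k -> 'rV[R]_m) (w : 'I_k -> R),
    [/\ forall i, X (x i), forall i, 0 <= w i, \sum_i w i = 1
      & z = \sum_i w i *: x i]].

Definition segment u v : set 'rV[R]_m :=
  [set z | exists t : R, 0 <= t <= 1 /\ z = (1 - t) *: u + t *: v].

Definition dotv u v : R := \sum_i u ord0 i * v ord0 i.

(* The face of P supported by the hyperplane with inner normal u. *)
Definition face P u : set 'rV[R]_m :=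
  [set z | P z /\ forall z', P z' -> dotv u z <= dotv u z'].

Definition hamming u v : nat := #|[set i | u ord0 i != v ord0 i]%SET|.

End ConvexGeometry.

Section InducedSubdivision.
Variables (R : realType) (n : nat).

Definition e_ (S : {set 'I_n}) : 'rV[R]_n := \row_i (i \in S)%:R.

(* A function {0,1}^n -> R u {oo} is encoded through the bijection S |-> e_S
   as p : {set 'I_n} -> option R: p S is its value at e_S, None stands for oo. *)
Implicit Type p : {set 'I_n} -> option R.

Definition lifted_points p : set 'rV[R]_(n + 1) :=
  [set z | exists S (c : R), p S = Some c /\ z = row_mx (e_ S) c%:M].

Definition lifted_polytope p : set 'rV[R]_(n + 1) :=
  conv_hull (lifted_points p).

Definition subdivision p : set (set 'rV[R]_n) :=
  [set E | exists u : 'rV[R]_(n + 1),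
    0 < u ord0 (rshift n ord0) /\ E = lsubmx @` face (lifted_polytope p) u].

(* A one-dimensional cell: the cells are polytopes, and the one-dimensional
   polytopes are the nondegenerate segments. *)
Definition subdivision_edge p (E : set 'rV[R]_n) : Prop :=
  subdivision p E /\ exists a b : 'rV[R]_n, a != b /\ E = segment a b.

Definition has_length (E : set 'rV[R]_n) (l : nat) : Prop :=
  exists S T : {set 'I_n},
    E = segment (e_ S) (e_ T) /\ hamming (e_ S) (e_ T) = l.

Definition valuated_delta_matroid p : Prop :=
  forall E, subdivision_edge p E -> exists2 l : nat, has_length E l & (l <= 2)%N.

End InducedSubdivision.

(* Main.v *)
Require Import Defs.
From mathcomp Require Import all_boot all_order all_algebra.
From mathcomp Require Import boolp classical_sets reals.
From mathcomp Require Import lra.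
Local Open Scope ring_scope.

(** The minimizers of [w(X) - h r_M(X)] are the first components of the
    minimizers [(X, B)], with [B] a basis, of a cost that is a sum over the
    coordinates. Suppose [S] and [T] are the only such [X], and choose optimal
    pairs [(S, A)] and [(T, B)] with [A] and [B] as close as possible. Let
    [d i] be the cost of replacing the [i]-th coordinate of [(S, A)] by that of
    [(T, B)]. If [A] and [B] differ in more than two places, then every exchange
    from [A] towards [B] must strictly increase the cost, since otherwise it
    would give a closer pair. Exchanging from [A] at the place where [d] is
    smallest gives [min d + max d > 0], and exchanging from [B] at the place
    where [d] is largest gives [min d + max d < 0]. *)

Set Implicit Arguments.
Unset Strict Implicit.
Unset Printing Implicit Defensive.

Import Order.TTheory GRing.Theory Num.Theory.

(** * Symmetric differences and coordinatewise replacement *)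

Section SymmetricDifference.
Variable T : finType.
Implicit Types A B U : {set T}.

Lemma in_symdiff A B i : (i \in symdiff A B) = ((i \in A) != (i \in B)).
Proof. by rewrite !inE; case: (i \in A); case: (i \in B). Qed.

Lemma symdiffC A B : symdiff A B = symdiff B A.
Proof. by rewrite /symdiff finset.setUC. Qed.

(** For [U] inside [symdiff A B] this is the exchange of the delta-matroid axiom; in this form the
    same [U] can also act on a second pair of sets. *)
Definition override U A B : {set T} :=
  [set i | if i \in U then i \in B else i \in A]%SET.

Lemma override_symdiff U A B :
  U \subset symdiff A B -> override U A B = symdiff A U.
Proof.
move=> /fintype.subsetP sU; apply/setP=> i; rewrite in_symdiff inE.
case: ifP => [/sU|_]; last by case: (i \in A).
by rewrite in_symdiff; case: (i \in A); case: (i \in B).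
Qed.

Lemma symdiff_override U A B :
  symdiff (override U A B) B = (symdiff A B :\: U)%SET.
Proof.
by apply/setP=> i; rewrite finset.in_setD !in_symdiff inE; case: ifP => //; rewrite eqxx.
Qed.

Lemma symdiff_overridel U A B : symdiff A (override U A B) \subset U.
Proof.
by apply/fintype.subsetP=> i; rewrite in_symdiff inE; case: ifP => //; rewrite eqxx.
Qed.

End SymmetricDifference.

(** If [a = b], the sum is the single term [d a], so [d a] and hence [M] are positive; otherwise
    [d b] is at most [M]. *)
Lemma sum_set2_gt0 (R : numDomainType) (I : finType) (d : I -> R) (a b : I) M :
  0 < \sum_(i in [set a; b]%SET) d i -> d a <= M -> d b <= M -> 0 < d a + M.
Proof.
have [<-|ab] := eqVneq a b.
  by rewrite finset.setUid big_set1 => da0 daM _; rewrite addr_gt0 // (lt_le_trans da0).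
rewrite big_setU1 ?inE // big_set1 => dab0 _ dbM.
by rewrite (lt_le_trans dab0) // lerD2l.
Qed.

(** * Minimizers of costs that are sums over the coordinates *)

Section SeparableCost.
Variables (R : realDomainType) (n : nat) (F : {set {set 'I_n}}).
Variables (cost : 'I_n -> bool -> bool -> R) (m : R).
Hypothesis deltaF : delta_matroid F.

Definition total_cost (X B : {set 'I_n}) : R :=
  \sum_i cost i (i \in X) (i \in B).

Hypothesis total_cost_ge : forall X B, B \in F -> m <= total_cost X B.

Definition override_cost (S A T B : {set 'I_n}) (i : 'I_n) : R :=
  cost i (i \in T) (i \in B) - cost i (i \in S) (i \in A).

Lemma override_costC S A T B i :
  override_cost T B S A i = - override_cost S A T B i.
Proof. by rewrite /override_cost opprB. Qed.

Lemma total_cost_override (U S A T B : {set 'I_n}) :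
  total_cost (override U S T) (override U A B) =
    total_cost S A + \sum_(i in U) override_cost S A T B i.
Proof.
rewrite /total_cost [X in _ + X]big_mkcond -big_split; apply: eq_bigr => i _ /=.
by rewrite /override_cost !inE; case: ifP => _; rewrite ?addr0 // addrC subrK.
Qed.

Definition only_minimizers (S T : {set 'I_n}) : Prop :=
  forall X B, B \in F -> total_cost X B = m -> X = S \/ X = T.

Definition closest (S A T B : {set 'I_n}) : Prop :=
  forall A' B', A' \in F -> B' \in F ->
    total_cost S A' = m -> total_cost T B' = m ->
    (#|symdiff A B| <= #|symdiff A' B'|)%N.

(** Otherwise the replaced pair would cost at most, hence exactly, [m], and its first component
    would be [S] or [T]. If [S], its basis is closer to [B], as the difference at [a] is gone; if
    [T], its basis is at distance at most 2 from [A]. Both contradict [closest]. *)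
Lemma exchange_increases_cost (S A T B : {set 'I_n}) (a : 'I_n) :
  only_minimizers S T -> closest S A T B -> A \in F -> B \in F ->
  total_cost S A = m -> total_cost T B = m -> (2 < #|symdiff A B|)%N ->
  a \in symdiff A B ->
  exists2 b, b \in symdiff A B &
    0 < \sum_(i in [set a; b]%SET) override_cost S A T B i.
Proof.
move=> onlyST clAB FA FB mA mB gt2 aD.
have [b bD FC] := deltaF FA FB aD; exists b => //.
set U := [set a; b]%SET in FC *.
have sU : U \subset symdiff A B.
  by apply/fintype.subsetP=> i; rewrite finset.in_set2 => /orP[] /eqP->.
rewrite -(override_symdiff sU) in FC.
rewrite ltNge; apply/negP => le0.
have eqm : total_cost (override U S T) (override U A B) = m.
  apply/eqP; rewrite eq_le total_cost_ge // andbT total_cost_override mA.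
  by rewrite gerDl.
case: (onlyST _ _ FC eqm) => eX; rewrite eX in eqm.
- have := clAB _ _ FC FB eqm mB; rewrite symdiff_override leqNgt => /negP; apply.
  apply: proper_card; apply/properP; split; first exact: finset.subsetDl.
  by exists a; rewrite // finset.in_setD !inE eqxx.
- have := clAB _ _ FA FC mA eqm; rewrite leqNgt => /negP; apply.
  apply: leq_ltn_trans gt2.
  apply: leq_trans (subset_leq_card (symdiff_overridel _ _ _)) _.
  by rewrite cards2; case: (a != b).
Qed.


Lemma card_symdiff_only_minimizers (S T : {set 'I_n}) :
  only_minimizers S T ->
  (exists2 A, A \in F & total_cost S A = m) ->
  (exists2 B, B \in F & total_cost T B = m) ->
  (#|symdiff S T| <= 2)%N.
Proof.
move=> onlyST [A0 FA0 mA0] [B0 FB0 mB0].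
pose good (P : {set 'I_n} * {set 'I_n}) :=
  [&& P.1 \in F, P.2 \in F, total_cost S P.1 == m & total_cost T P.2 == m].
have good0 : good (A0, B0) by rewrite /good FA0 FB0 mA0 mB0 !eqxx.
case: (arg_minnP (fun P => #|symdiff P.1 P.2|) good0) => -[A B] /=.
rewrite /good /= => /and4P[FA FB /eqP mA /eqP mB] minAB.
have clAB : closest S A T B.
  by move=> A' B' FA' FB' /eqP mA' /eqP mB'; apply: (minAB (A', B')); apply/and4P.
have clBA : closest T B S A.
  by move=> B' A' FB' FA' mB' mA'; rewrite symdiffC (symdiffC B') clAB.
have onlyTS : only_minimizers T S.
  by move=> X C FC mC; case: (onlyST _ _ FC mC); [right | left].
have [sub | /subsetPn[i iST iAB]] := boolP (symdiff S T \subset symdiff A B).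
(* Here [S] and [T] are at most as far apart as [A] and [B], so it suffices to bound the latter
   distance. *)
- rewrite leqNgt; apply/negP => gt2.
  have {gt2} gt2 := leq_trans gt2 (subset_leq_card sub).
  have [a0 a0D] : exists a, a \in symdiff A B.
    by apply/card_gt0P; apply: leq_trans gt2.
  pose d := override_cost S A T B.
  case: (@Order.TotalTheory.arg_minP _ _ _ a0 (mem (symdiff A B)) d a0D) => a aD mina.
  case: (@Order.TotalTheory.arg_maxP _ _ _ a0 (mem (symdiff A B)) d a0D) => c cD maxc.
  have [b bD gt0] := exchange_increases_cost onlyST clAB FA FB mA mB gt2 aD.
  have := gt2; rewrite symdiffC => gt2'.
  have cD' : c \in symdiff B A by rewrite symdiffC.
  have [b' ] := exchange_increases_cost onlyTS clBA FB FA mB mA gt2' cD'.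
  rewrite symdiffC => b'D.
  under eq_bigr do rewrite override_costC -/(d _).
  (* For [- d] the roles swap: its least value is at [c] and its greatest is [- d a]. *)
  move=> /(sum_set2_gt0 (M := - d a)); rewrite !lerN2 => /(_ (mina _ cD) (mina _ b'D)).
  rewrite -opprD oppr_gt0 addrC ltNge => /negP; apply; apply: ltW.
  by apply: sum_set2_gt0 gt0 _ _; apply: maxc.
(* At [i], [S] and [T] differ but [A] and [B] agree, so this coordinate can be changed in [S] or in
   [T] with the basis kept. The two cost changes are opposite and both nonnegative, hence zero. The
   changed [S] is then a minimizer other than [S], so it is [T]. *)
- have eA : override [set i]%SET A B = A.
    apply/setP=> j; rewrite !inE; case: eqP => // ->.
    by move: iAB; rewrite in_symdiff negbK => /eqP.
  have eB : override [set i]%SET B A = B.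
    apply/setP=> j; rewrite !inE; case: eqP => // ->.
    by move: iAB; rewrite in_symdiff negbK => /eqP.
  have := total_cost_override [set i]%SET S A T B.
  have := total_cost_override [set i]%SET T B S A.
  rewrite eA eB mA mB !big_set1 override_costC => e1 e2.
  have := total_cost_ge (override [set i]%SET S T) FA.
  have := total_cost_ge (override [set i]%SET T S) FB.
  rewrite e1 e2 !lerDl oppr_ge0 => d_le0 d_ge0.
  have em : total_cost (override [set i]%SET S T) A = m.
    by apply/eqP; rewrite e2 eq_le gerDl lerDl d_le0.
  case: (onlyST _ _ FA em) => eX.
  + move: iST; rewrite in_symdiff -{1}eX !inE eqxx.
    by rewrite eqxx.
  + rewrite -[X in symdiff S X]eX.
    apply: leq_trans (subset_leq_card (symdiff_overridel _ _ _)) _.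
    by rewrite cards1.
Qed.

End SeparableCost.

(** * Lower faces as sets of minimizers, and edges as pairs of them *)

Section RegularSubdivision.
Variables (R : realType) (n : nat) (f : {set 'I_n} -> R).
Implicit Types (X S T : {set 'I_n}) (u : 'rV[R]_(n + 1)).

Definition lift_point X : 'rV[R]_(n + 1) := row_mx (e_ R X) (f X)%:M.

Definition height u X : R := dotv u (lift_point X).

Lemma heightE u X : height u X =
  \sum_i u ord0 (lshift 1 i) * (i \in X)%:R + u ord0 (rshift n ord0) * f X.
Proof.
rewrite /height /dotv big_split_ord big_ord1 /=; congr (_ + _).
  by apply: eq_bigr => i _; rewrite row_mxEl mxE.
by rewrite row_mxEr mxE eqxx mulr1n.
Qed.

Lemma dotv_sum (m k : nat) (v : 'rV[R]_m) (w : 'I_k -> R)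
    (x : 'I_k -> 'rV[R]_m) :
  dotv v (\sum_i w i *: x i) = \sum_i w i * dotv v (x i).
Proof.
rewrite /dotv; under eq_bigr do rewrite summxE mulr_sumr.
rewrite exchange_big; apply: eq_bigr => i _; rewrite mulr_sumr.
by apply: eq_bigr => j _; rewrite mxE mulrCA.
Qed.

Let p X := Some (f X).

Definition minimizes u X := forall Y, height u X <= height u Y.

Lemma exists_minimizes u : exists X, minimizes u X.
Proof.
case: (@Order.TotalTheory.arg_minP _ _ _ (finset.set0 : {set 'I_n}) predT (height u))
  => // X _ minX.
by exists X => Y; apply: minX.
Qed.

Lemma lifted_polytopeP (z : 'rV[R]_(n + 1)) : lifted_polytope p z ->
  exists k (X : 'I_k -> {set 'I_n}) (w : 'I_k -> R),
    [/\ forall i, 0 <= w i, \sum_i w i = 1 & z = \sum_i w i *: lift_point (X i)].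
Proof.
move=> [k [x [w [xP w0 w1 ->]]]].
have /choice[X eX] : forall i, exists X, x i = lift_point X.
  by move=> i; have [X [c [[<-] ->]]] := xP i; exists X.
by exists k, X, w; split=> //; apply: eq_bigr => i _; rewrite eX.
Qed.

Lemma face_lift_point u X :
  minimizes u X -> face (lifted_polytope p) u (lift_point X).
Proof.
move=> minX; split.
  exists 1%N, (fun=> lift_point X), (fun=> 1); split=> //.
  - by move=> _; exists X, (f X).
  - by rewrite big_ord1.
  - by rewrite big_ord1 scale1r.
move=> z /lifted_polytopeP[k [Y [w [w0 w1 ->]]]].
rewrite dotv_sum -[leLHS]mul1r -w1 mulr_suml.
by apply: ler_sum => i _; apply: ler_wpM2l => //; apply: minX.
Qed.

(** The weighted excesses of the heights over the minimum are nonnegative, and on a face their sum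
    is at most zero. So each one vanishes, and positive weight forces zero excess. *)
Lemma faceP u (z : 'rV[R]_(n + 1)) : face (lifted_polytope p) u z ->
  exists k (X : 'I_k -> {set 'I_n}) (w : 'I_k -> R),
    [/\ forall i, 0 <= w i, \sum_i w i = 1, z = \sum_i w i *: lift_point (X i)
      & forall i, w i != 0 -> minimizes u (X i)].
Proof.
move=> [/lifted_polytopeP[k [X [w [w0 w1 ez]]]] minz].
exists k, X, w; split=> // i wi0 Y.
have [X0 minX0] := exists_minimizes u.
apply: le_trans (minX0 Y).
have ge0 j : true -> 0 <= w j * (height u (X j) - height u X0).
  by move=> _; rewrite mulr_ge0 ?subr_ge0.
have sum0 : \sum_j w j * (height u (X j) - height u X0) = 0.
  apply/eqP; rewrite eq_le sumr_ge0 // andbT.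
  under eq_bigr do rewrite mulrBr.
  rewrite sumrB -mulr_suml w1 mul1r subr_le0 -dotv_sum -ez.
  by apply: minz; case: (face_lift_point minX0).
have /eqP := psumr_eq0P ge0 sum0 (i := i) isT.
by rewrite mulf_eq0 (negPf wi0) subr_eq0 => /eqP->.
Qed.

Lemma e_inj : injective (e_ R (n := n)).
Proof.
move=> S T /rowP eST; apply/setP=> i; have := eST i; rewrite !mxE.
by case: (i \in S); case: (i \in T) => // /eqP; rewrite ?oner_eq0 // eq_sym oner_eq0.
Qed.

Lemma hamming_e_ S T : hamming (e_ R S) (e_ R T) = #|symdiff S T|.
Proof.
congr #|pred_of_set _|; apply/setP=> i; rewrite in_symdiff inE !mxE.
case: (i \in S); case: (i \in T); rewrite ?eqxx ?oner_eq0 //.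
by rewrite eq_sym oner_eq0.
Qed.

(* Along a line, a nonconstant coordinate separates points, and on cube
   vertices it takes only two values. *)
Lemma cube_vertices_on_segment (a b : 'rV[R]_n) S T X : a != b -> S != T ->
  segment a b (e_ R S) -> segment a b (e_ R T) -> segment a b (e_ R X) ->
  X = S \/ X = T.
Proof.
move=> ab ST [s [_ eS]] [t [_ eT]] [x [_ eX]].
have [i abi] : exists i, a ord0 i != b ord0 i.
  apply/existsP; rewrite -negb_forall; apply: contra ab => /forallP eab.
  by apply/eqP/rowP => i; apply/eqP.
have coord Y y : e_ R Y = (1 - y) *: a + y *: b ->
    (i \in Y)%:R = a ord0 i + y * (b ord0 i - a ord0 i).
  by move=> /rowP/(_ i); rewrite !mxE => ->; lra.
have sep Y Z y z : e_ R Y = (1 - y) *: a + y *: b ->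
    e_ R Z = (1 - z) *: a + z *: b -> (i \in Y) = (i \in Z) -> Y = Z.
  move=> eY eZ eYZ; apply: e_inj; rewrite eY eZ.
  suff -> : y = z by [].
  have := coord _ _ eY; rewrite eYZ (coord _ _ eZ) => /addrI/mulIf -> //.
  by rewrite subr_eq0 eq_sym.
have [eXS|nXS] := eqVneq (i \in X) (i \in S); first by left; apply: sep eX eS eXS.
have [eXT|nXT] := eqVneq (i \in X) (i \in T); first by right; apply: sep eX eT eXT.
case/eqP: ST; apply: sep eS eT _.
by move: nXS nXT; case: (i \in X); case: (i \in S); case: (i \in T).
Qed.

(** The face is the hull of the lifted minimizers. There are at least two, or [E] would be a single
    point, and no third, since all of them are cube vertices on one segment. *)
Lemma subdivision_edge_minimizers (E : set 'rV[R]_n) : subdivision_edge p E ->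
  exists u S T, [/\ 0 < u ord0 (rshift n ord0),
    E = segment (e_ R S) (e_ R T), minimizes u S, minimizes u T
    & forall X, minimizes u X -> X = S \/ X = T].
Proof.
move=> [[u [u0 eE]] [a [b [ab eab]]]].
have memE X : minimizes u X -> segment a b (e_ R X).
  move=> minX; rewrite -eab eE; exists (lift_point X).
    exact: face_lift_point.
  by rewrite /lift_point row_mxKl.
have hullE z : E z -> exists k (X : 'I_k -> {set 'I_n}) (w : 'I_k -> R),
    [/\ forall i, 0 <= w i, \sum_i w i = 1, z = \sum_i w i *: e_ R (X i)
      & forall i, w i != 0 -> minimizes u (X i)].
  rewrite eE => -[_ /faceP[k [X [w [w0 w1 -> minX]]]] <-].
  exists k, X, w; split=> //; rewrite linear_sum; apply: eq_bigr => i _.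
  by rewrite linearZ /= /lift_point row_mxKl.
have [S minS] := exists_minimizes u.
have [T [minT ST]] : exists T, minimizes u T /\ S != T.
  apply: contrapT => noT.
  have onlyS X : minimizes u X -> X = S.
    move=> minX; apply/eqP; rewrite eq_sym; apply/negPn/negP => SX; apply: noT.
    by exists X.
  have eqS z : E z -> z = e_ R S.
    move=> /hullE[k [X [w [_ w1 -> minX]]]].
    rewrite -[RHS]scale1r -w1 scaler_suml; apply: eq_bigr => i _.
    have [->|/minX/onlyS->//] := eqVneq (w i) 0.
    by rewrite !scale0r.
  have Ea : E a.
    by rewrite eab; exists 0; rewrite lexx ler01 subr0 scale0r scale1r addr0.
  have Eb : E b.
    by rewrite eab; exists 1; rewrite lexx ler01 subrr scale0r scale1r add0r.
  by case/eqP: ab; rewrite (eqS _ Ea) (eqS _ Eb).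
have onlyST X : minimizes u X -> X = S \/ X = T.
  by move=> minX; apply: (cube_vertices_on_segment ab ST); apply: memE.
exists u, S, T; split=> //; apply/seteqP; split=> z.
- move=> /hullE[k [X [w [w0 w1 -> minX]]]].
  have split1 : \sum_i w i = \sum_(i | X i == T) w i + \sum_(i | X i != T) w i.
    by rewrite (bigID (fun i => X i == T)).
  (* The parameter on the segment is the total weight carried by [T]. *)
  exists (\sum_(i | X i == T) w i); split.
    apply/andP; split; first by apply: sumr_ge0.
    by rewrite -w1 split1 lerDl sumr_ge0.
  rewrite -w1 split1 [X in X - _]addrC addrK (bigID (fun i => X i == T)) /= addrC.
  rewrite !scaler_suml; congr (_ + _); apply: eq_bigr => i; last by move=> /eqP->.
  have [->|/minX/onlyST[-> //|->]] := eqVneq (w i) 0; last by rewrite eqxx.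
  by rewrite !scale0r.
- move=> [r [/andP[r0 r1] ->]]; rewrite eab.
  have [s [/andP[s0 s1] ->]] := memE _ minS.
  have [t [/andP[t0 t1] ->]] := memE _ minT.
  (* The parameter along [a b] is the same convex combination of the parameters of the two
     endpoints. *)
  exists ((1 - r) * s + r * t); split; first by apply/andP; split; nra.
  by apply/rowP => i; rewrite !mxE; lra.
Qed.

End RegularSubdivision.

(** * The rank as a maximum of sums over the coordinates *)

Section Rank.
Variables (n : nat) (F : {set {set 'I_n}}).

Definition agreement (B X : {set 'I_n}) : nat :=
  (#|B :&: X| + #|~: B :&: ~: X|)%N%SET.

(** This form lets the agreement enter a [total_cost], which the rank itself cannot do. *)
Lemma agreementE B X : agreement B X = (\sum_i ((i \in X) == (i \in B)))%N.
Proof.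
rewrite /agreement -!sum1_card !(big_mkcond (fun i => i \in _)) -big_split /=.
by apply: eq_bigr => i _; rewrite !inE; case: (i \in B); case: (i \in X).
Qed.

Lemma agreement_le_rank B X : B \in F -> (agreement B X <= rank F X)%N.
Proof. exact: (@leq_bigmax_cond _ _ (agreement^~ X)). Qed.

Lemma rank_attained X :
  F != finset.set0 -> exists2 B, B \in F & rank F X = agreement B X.
Proof.
rewrite -card_gt0 => /(eq_bigmax_cond (agreement^~ X))[B FB eB].
by exists B.
Qed.

End Rank.

(** * Edges of the subdivision induced by minus the rank function *)

Lemma delta_matroid1 (n : nat) (B : {set 'I_n}) : delta_matroid [set B]%SET.
Proof. by move=> A C; rewrite !inE => /eqP-> /eqP-> a; rewrite in_symdiff eqxx. Qed.

Theorem theorem4p3 (R : realType) (n : nat) (F : {set {set 'I_n}})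
  (hF : delta_matroid F) :
  valuated_delta_matroid (fun S : {set 'I_n} => Some (- (rank F S)%:R : R)).
Proof.
move=> E /subdivision_edge_minimizers[u [S [T [u0 eE minS minT onlyST]]]].
exists #|symdiff S T|; first by exists S, T; rewrite hamming_e_.
pose h := height (fun X => - (rank F X)%:R) u.
have hST : h T = h S by apply/eqP; rewrite eq_le (minS T) (minT S).
have onlym X : h X = h S -> X = S \/ X = T.
  by move=> eX; apply: onlyST => Y; rewrite -/(h X) eX; apply: minS.
pose w i := u ord0 (lshift 1 i); pose c := u ord0 (rshift n ord0).
have [F0|F0] := eqVneq F finset.set0.
  (* The empty maximum gives rank 0, so the cost is linear in X and any
     one-basis delta-matroid may stand in for F. *)
  pose cost i (x _ : bool) := w i * x%:R.
  have costE X B : total_cost cost X B = h X.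
    rewrite /h heightE F0 /rank big_pred0 ?oppr0 ?mulr0 ?addr0 // => B'.
    by rewrite inE.
  apply: (@card_symdiff_only_minimizers R n _ cost (h S)
            (@delta_matroid1 n finset.set0)).
  - by move=> X B _; rewrite costE; apply: minS.
  - by move=> X B _; rewrite costE; apply: onlym.
  - by exists finset.set0; rewrite ?inE.
  - by exists finset.set0; rewrite ?inE ?costE.
(* The excess of this cost over [h X] is [c] times the shortfall of [B] from the rank. As [c] is
   positive and [F] nonempty, minimizing over the bases gives back [h X]. *)
pose cost i (x y : bool) := w i * x%:R - c * (x == y)%:R.
have costE X B : total_cost cost X B =
    h X + c * ((rank F X)%:R - (agreement B X)%:R).
  rewrite /h heightE /total_cost /cost sumrB -mulr_sumr -natr_sum -agreementE.
  rewrite -/c /w; lra.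
have cost_ge X B : B \in F -> h X <= total_cost cost X B.
  move=> FB; rewrite costE lerDl mulr_ge0 ?(ltW u0) //.
  by rewrite subr_ge0 ler_nat agreement_le_rank.
have cost_eq X : exists2 B, B \in F & total_cost cost X B = h X.
  have [B FB eB] := rank_attained X F0.
  by exists B; rewrite // costE eB subrr mulr0 addr0.
apply: (@card_symdiff_only_minimizers R n F cost (h S) hF) => //.
- by move=> X B FB; apply: le_trans (minS X) (cost_ge _ _ FB).
(* A pair of cost [h S] has [h X] at most [h S], so [X] is itself a minimizer of the height. *)
- move=> X B FB eX; apply: onlym; apply/eqP; rewrite eq_le (minS X) andbT.
  by rewrite -eX cost_ge.
- by rewrite -hST.
Qed.
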